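(* Let $p\ge 3$ be odd, let $q$ be a primitive $p$-th root of unity, and let $A=A(E(1,1\mid p))$ be the reduced quantum Poincaré group (the $p^3$-dimensional Hopf algebra defined in the context). The linear functional $\mathcal I:A\to\mathbb C$ given on the basis $\eta_+^n\eta_-^m\delta^k$ ($n,m,k\in\{0,\dots,p-1\}$) by $$\mathcal I(\eta_+^n\eta_-^m\delta^k)=q^{-1}\,\delta_{n,p-1}\,\delta_{m,p-1}\,\delta_{k,0\,(\mathrm{mod}\ p)}$$ is an invariant integral on $A$, i.e. for all $a\in A$ $$(\mathrm{id}\otimes\mathcal I)\Delta(a)=\mathcal I(a)1_A,\qquad (\mathcal I\otimes\mathrm{id})\Delta(a)=\mathcal I(a)1_A ,$$ and it is the unique one up to a scalar: every linear functional on $A$ satisfying these left and right invariance conditions is a complex multiple of $\mathcal I$.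
   Context: $A(E(1,1\mid p))$ is the unital complex associative algebra generated by $\eta_+,\eta_-,\delta$ with relations $$\eta_-\eta_+=q^2\eta_+\eta_-,\quad \eta_\pm\delta=q^2\delta\eta_\pm,\quad \delta^p=1_A,\quad \eta_\pm^p=0,$$ with linear basis $\eta_+^n\eta_-^m\delta^k$, $n,m,k\in\{0,\dots,p-1\}$. It is a Hopf algebra with $$\Delta(\eta_\pm)=\eta_\pm\otimes 1_A+\delta^{\pm1}\otimes\eta_\pm,\quad \Delta(\delta)=\delta\otimes\delta,\quad \varepsilon(\delta)=1,\ \varepsilon(\eta_\pm)=0,\quad S(\delta^{\pm1})=\delta^{\mp1},\ S(\eta_\pm)=-\delta^{\mp1}\eta_\pm .$$ The symbol $\delta_{a,b}$ with two indices is the Kronecker delta (not the generator $\delta$). *)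

(* Defs.v *)
From HB Require Import structures.
From mathcomp Require Import all_boot all_order all_algebra all_field.
From mathcomp Require Import reals.
From mathcomp.real_closed Require Import complex.

Set Implicit Arguments.
Unset Strict Implicit.
Unset Printing Implicit Defensive.

Import GRing.Theory.
Local Open Scope ring_scope.

(* An element of U ⊗ V is the matrix of its coordinates on the vectors        *)
(* e_i ⊗ f_j, where (e_i) and (f_j) are the bases vbasis {:U} and vbasis {:V}.*)
(* The type is an alias so that it does not inherit the product of square     *)
(* matrices.                                                                  *)
Section TensorSpace.

Variable K : fieldType.

Definition tensor (U V : vectType K) : Type := 'M[K]_(\dim {:U}, \dim {:V}).

HB.instance Definition _ (U V : vectType K) :=
  Vector.copy (tensor U V) 'M[K]_(\dim {:U}, \dim {:V}).

Definition tbas (U : vectType K) (i : 'I_(\dim {:U})) : U := (vbasis {:U})`_i.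

Definition tcoord (U : vectType K) (i : 'I_(\dim {:U})) (u : U) : K :=
  coord (vbasis {:U}) i u.

Definition tens (U V : vectType K) (u : U) (v : V) : tensor U V :=
  \matrix_(i, j) (tcoord i u * tcoord j v).

(* The linear map induced on U ⊗ V by a bilinear map h, see tliftE.           *)
Definition tlift (U V : vectType K) (W : lmodType K) (h : U -> V -> W)
    (x : tensor U V) : W :=
  \sum_i \sum_j x i j *: h (tbas i) (tbas j).

Definition bilin (U V : vectType K) (W : lmodType K) (h : U -> V -> W) : Prop :=
  (forall v, linear (fun u => h u v)) /\ (forall u, linear (h u)).

Lemma tbasE (U : vectType K) (u : U) : u = \sum_i tcoord i u *: tbas i.
Proof. exact: coord_vbasis (memvf u). Qed.

Lemma tcoord_tbas (U : vectType K) (i j : 'I_(\dim {:U})) :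
  tcoord i (tbas j) = (i == j)%:R.
Proof. by rewrite /tcoord coord_free ?(basis_free (vbasisP _)) // eq_sym. Qed.

Lemma tens_delta (U V : vectType K) i j :
  tens (tbas i : U) (tbas j : V) = delta_mx i j.
Proof. by apply/matrixP => a b; rewrite !mxE !tcoord_tbas -natrM mulnb. Qed.

Lemma tensorE (U V : vectType K) (x : tensor U V) :
  x = \sum_i \sum_j x i j *: tens (tbas i : U) (tbas j : V).
Proof.
rewrite {1}[x]matrix_sum_delta.
by apply: eq_bigr => i _; apply: eq_bigr => j _; rewrite tens_delta.
Qed.

Lemma tens_bilin (U V : vectType K) : bilin (@tens U V).
Proof.
split=> [v|u] a x y; apply/matrixP => i j; rewrite !mxE /tcoord linearP /=.
  by rewrite mulrDl mulrA.
by rewrite mulrDr mulrCA.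
Qed.

Lemma tlift_is_linear (U V : vectType K) (W : lmodType K) (h : U -> V -> W) :
  linear (tlift h).
Proof.
move=> a x y; rewrite /tlift scaler_sumr -big_split; apply: eq_bigr => i _ /=.
rewrite scaler_sumr -big_split; apply: eq_bigr => j _ /=.
by rewrite !mxE scalerDl scalerA.
Qed.

HB.instance Definition _ (U V : vectType K) (W : lmodType K) (h : U -> V -> W) :=
  GRing.isLinear.Build K (tensor U V) W *:%R (tlift h) (tlift_is_linear h).

Lemma tliftE (U V : vectType K) (W : lmodType K) (h : U -> V -> W) u v :
  bilin h -> tlift h (tens u v) = h u v.
Proof.
case=> hl hr.
pose hL v := GRing.isLinear.Build K U W *:%R _ (hl v).
pose HL v : {linear U -> W} := HB.pack (fun u => h u v) (hL v).
pose hR u := GRing.isLinear.Build K V W *:%R _ (hr u).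
pose HR u : {linear V -> W} := HB.pack (h u) (hR u).
rewrite {2}[u]tbasE; rewrite -[RHS]/(HL v _) linear_sum.
rewrite /tlift; apply: eq_bigr => i _; rewrite linearZ /=.
rewrite {2}[v]tbasE -[h _ _]/(HR _ _) linear_sum scaler_sumr.
apply: eq_bigr => j _; rewrite linearZ /= scalerA; congr (_ *: _).
by rewrite mxE.
Qed.

Lemma eq_tensor (U V : vectType K) (W : lmodType K)
    (f g : {linear tensor U V -> W}) :
  (forall u v, f (tens u v) = g (tens u v)) -> f =1 g.
Proof.
move=> fg x; rewrite [x]tensorE !linear_sum; apply: eq_bigr => i _.
rewrite !linear_sum; apply: eq_bigr => j _.
by rewrite !linearZ /= fg.
Qed.

Definition tmap (U V U' V' : vectType K) (f : U -> U') (g : V -> V') :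
    tensor U V -> tensor U' V' :=
  tlift (fun u v => tens (f u) (g v)).

Definition tassoc (U V W : vectType K) :
    tensor (tensor U V) W -> tensor U (tensor V W) :=
  tlift (fun x w => tlift (fun u v => tens u (tens v w)) x).

(* (id ⊗ I) and (I ⊗ id), with values in U ⊗ K = U and K ⊗ V = V.             *)
Definition id_tens (U V : vectType K) (I : V -> K) : tensor U V -> U :=
  tlift (fun u v => I v *: u).

Definition tens_id (U V : vectType K) (I : U -> K) : tensor U V -> V :=
  tlift (fun u v => I u *: v).

Lemma tmapE (U V U' V' : vectType K) (f : {linear U -> U'})
    (g : {linear V -> V'}) u v :
  tmap f g (tens u v) = tens (f u) (g v).
Proof.
have [tl tr] := tens_bilin U' V'.
by apply: (tliftE (h := fun u v => tens (f u) (g v))); split=> [b|a] k x y;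
  rewrite /= linearP ?tl ?tr.
Qed.

Lemma tassocE (U V W : vectType K) (u : U) (v : V) (w : W) :
  tassoc (tens (tens u v) w) = tens u (tens v w).
Proof.
have [tl tr] := tens_bilin U (tensor V W).
have [tl' tr'] := tens_bilin V W.
rewrite /tassoc tliftE; last first.
  split=> [c|x] k y z; first exact: tlift_is_linear.
  rewrite /tlift scaler_sumr -big_split; apply: eq_bigr => i _ /=.
  rewrite scaler_sumr -big_split; apply: eq_bigr => j _ /=.
  by rewrite tr' tr scalerDr !scalerA mulrC.
by apply: (tliftE (h := fun u v => tens u (tens v w))); split=> [b|a] k x y;
  rewrite ?tl ?tl' ?tr.
Qed.

Lemma id_tensE (U V : vectType K) (I : {scalar V}) (u : U) v :
  id_tens I (tens u v) = I v *: u.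
Proof.
apply: (tliftE (h := fun u v => I v *: u)).
split=> [b|a] k x y; first by rewrite scalerDr !scalerA mulrC.
by rewrite linearP scalerDl scalerA.
Qed.

Lemma tens_idE (U V : vectType K) (I : {scalar U}) u (v : V) :
  tens_id I (tens u v) = I u *: v.
Proof.
apply: (tliftE (h := fun u v => I u *: v)).
split=> [b|a] k x y; first by rewrite linearP scalerDl scalerA.
by rewrite scalerDr !scalerA mulrC.
Qed.

End TensorSpace.

Section TensorAlgebra.

Variables (K : fieldType) (A B : falgType K).
Notation T := (tensor A B).

Definition tone : T := tens (1 : A) (1 : B).

Definition tmul (x y : T) : T :=
  tlift (fun a b => tlift (fun c d => tens (a * c) (b * d)) y) x.

Lemma bilin_mul a b :
  bilin (fun (c : A) (d : B) => tens (a * c) (b * d)).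
Proof.
have [tl tr] := tens_bilin A B.
by split=> [d|c] k x y; rewrite mulrDr -scalerAr ?tl ?tr.
Qed.

Lemma tlift_mulrE x : bilin (fun (a : A) (b : B) =>
  tlift (fun c d => tens (a * c) (b * d)) x : T).
Proof.
have [tl tr] := tens_bilin A B.
split=> [b|a] k u v; rewrite /tlift scaler_sumr -big_split;
  apply: eq_bigr => i _ /=; rewrite scaler_sumr -big_split;
  apply: eq_bigr => j _ /=;
  by rewrite mulrDl -scalerAl ?tl ?tr scalerDr !scalerA mulrC.
Qed.

Lemma tmulE a b c d :
  tmul (tens a b) (tens c d) = tens (a * c) (b * d).
Proof.
by rewrite /tmul tliftE ?tliftE //; [apply: bilin_mul | apply: tlift_mulrE].
Qed.

Lemma tmul_linearl y : linear (tmul^~ y).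
Proof. exact: tlift_is_linear. Qed.

Lemma tmul_linearr x : linear (tmul x).
Proof.
move=> k y z; rewrite /tmul ![tlift _ x]/tlift scaler_sumr -big_split.
apply: eq_bigr => i _ /=; rewrite scaler_sumr -big_split.
apply: eq_bigr => j _ /=.
by rewrite tlift_is_linear scalerDr !scalerA mulrC.
Qed.

Let tmulr y : {linear T -> T} :=
  HB.pack (fun x => tmul x y) (GRing.isLinear.Build K T T *:%R _ (tmul_linearl y)).
Let tmull x : {linear T -> T} :=
  HB.pack (tmul x) (GRing.isLinear.Build K T T *:%R _ (tmul_linearr x)).

Lemma tmulA : associative tmul.
Proof.
move=> x y z.
apply: (@eq_tensor _ _ _ _ (tmulr (tmul y z)) (tmulr z \o tmulr y)) => a b /=.
apply: (@eq_tensor _ _ _ _ (tmull (tens a b) \o tmulr z)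
                           (tmulr z \o tmull (tens a b))) => c d /=.
apply: (@eq_tensor _ _ _ _ (tmull (tens a b) \o tmull (tens c d))
                           (tmull (tmul (tens a b) (tens c d)))) => e f /=.
by rewrite !tmulE !mulrA.
Qed.

Lemma tmul1 : left_id tone tmul.
Proof.
move=> x; apply: (@eq_tensor _ _ _ _ (tmull tone) idfun) => a b /=.
by rewrite tmulE !mul1r.
Qed.

Lemma tmulr1 : right_id tone tmul.
Proof.
move=> x; apply: (@eq_tensor _ _ _ _ (tmulr tone) idfun) => a b /=.
by rewrite tmulE !mulr1.
Qed.

Lemma tmulDl : left_distributive tmul +%R.
Proof. by move=> x y z; apply: (linearD (tmulr z)). Qed.

Lemma tmulDr : right_distributive tmul +%R.
Proof. by move=> x y z; apply: (linearD (tmull x)). Qed.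

Lemma tone_neq0 : tone != 0.
Proof.
have nz (C : falgType K) :
    exists i, tcoord i (1 : C) != 0.
  apply/existsP; apply: contraNT (oner_neq0 C); rewrite negb_exists => /forallP h.
  rewrite [1]tbasE big1 // => i _.
  by move: (h i); rewrite negbK => /eqP->; rewrite scale0r.
have [[i hi] [j hj]] := (nz A, nz B).
apply: contraNneq (mulf_neq0 hi hj) => /matrixP/(_ i j).
by rewrite !mxE => ->.
Qed.

HB.instance Definition _ := GRing.Zmodule_isNzRing.Build T
  tmulA tmul1 tmulr1 tmulDl tmulDr tone_neq0.

Lemma tscaleAl (k : K) (x y : T) : k *: (x * y) = k *: x * y.
Proof. by rewrite -[RHS]/(tmulr y _) linearZ. Qed.

Lemma tscaleAr (k : K) (x y : T) : k *: (x * y) = x * (k *: y).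
Proof. by rewrite -[RHS]/(tmull x _) linearZ. Qed.

HB.instance Definition _ := GRing.Lmodule_isLalgebra.Build K T tscaleAl.
HB.instance Definition _ := GRing.Lalgebra_isAlgebra.Build K T tscaleAr.
HB.instance Definition _ := Algebra_isFalgebra.Build K T.

End TensorAlgebra.

Notation "A ⊗ B" := (tensor A B) (at level 40, left associativity) : type_scope.
Notation "a ⊗ b" := (tens a b) (at level 40, left associativity) : ring_scope.

Section HopfAlgebra.

Variables (K : fieldType) (A : falgType K).

Record hopf_algebra (Delta : {lrmorphism A -> (A ⊗ A)%type})
    (eps : {lrmorphism A -> K^o}) (S : {linear A -> A}) : Prop := {
  hopf_coassoc : forall a,
    tassoc (tmap Delta idfun (Delta a)) = tmap idfun Delta (Delta a);
  hopf_counitl : forall a, tens_id eps (Delta a) = a;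
  hopf_counitr : forall a, id_tens eps (Delta a) = a;
  hopf_antipodel : forall a,
    tlift (fun b c => S b * c) (Delta a) = (eps a : K) *: 1;
  hopf_antipoder : forall a,
    tlift (fun b c => b * S c) (Delta a) = (eps a : K) *: 1 }.

Definition invariant_integral (Delta : A -> (A ⊗ A)%type) (I : A -> K) : Prop :=
  forall a, id_tens I (Delta a) = I a *: 1 /\ tens_id I (Delta a) = I a *: 1.

End HopfAlgebra.

Section ReducedQuantumPoincare.

Variables (R : realType) (p : nat) (q : R[i]) (A : falgType R[i]).
Variables etap etam delta : A.

Definition monomial (x : 'I_p * 'I_p * 'I_p) : A :=
  etap ^+ x.1.1 * etam ^+ x.1.2 * delta ^+ x.2.

(* An algebra satisfying the relations in which the normally ordered          *)
(* monomials form a basis is the algebra presented by those relations.        *)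
Record E11_algebra : Prop := {
  E11_etam_etap : etam * etap = q ^+ 2 *: (etap * etam);
  E11_etap_delta : etap * delta = q ^+ 2 *: (delta * etap);
  E11_etam_delta : etam * delta = q ^+ 2 *: (delta * etam);
  E11_delta_p : delta ^+ p = 1;
  E11_etap_p : etap ^+ p = 0;
  E11_etam_p : etam ^+ p = 0;
  E11_basis : basis_of {:A} (codom monomial) }.

Record reduced_quantum_Poincare (Delta : {lrmorphism A -> (A ⊗ A)%type})
    (eps : {lrmorphism A -> R[i]^o}) (S : {linear A -> A}) : Prop := {
  rqP_algebra : E11_algebra;
  rqP_hopf : hopf_algebra Delta eps S;
  rqP_Delta_etap : Delta etap = etap ⊗ 1 + delta ⊗ etap;
  rqP_Delta_etam : Delta etam = etam ⊗ 1 + delta^-1 ⊗ etam;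
  rqP_Delta_delta : Delta delta = delta ⊗ delta;
  rqP_eps_delta : eps delta = 1;
  rqP_eps_etap : eps etap = 0;
  rqP_eps_etam : eps etam = 0;
  rqP_S_delta : S delta = delta^-1;
  rqP_S_deltaV : S delta^-1 = delta;
  rqP_S_etap : S etap = - (delta^-1 * etap);
  rqP_S_etam : S etam = - (delta * etam) }.

End ReducedQuantumPoincare.

(* Main.v *)
(* By the q-binomial theorem, Delta (etap^n etam^m delta^k) is a combination of
   etap^(n-a) etam^(m-b) delta^(a-b+k) ⊗ etap^a etam^b delta^k for a <= n, b <= m,
   with coefficient 1 at (a, b) = (0, 0) and (n, m). A functional supported on
   the top monomial only sees these two corners, which gives its invariance.
   Conversely let J be invariant. The (0, 0) corner forces
   J (etap^n etam^m delta^k) = 0 unless k = 0, the (n, m) corner then forces it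
   unless n = m, and the coefficient of etap in
   (id ⊗ J) (Delta (etap^(n+1) etam^n)) is J (etap^n etam^n) times the quantum
   integer [n+1], which is nonzero for n+1 < p. *)
Require Import Defs.
From HB Require Import structures.
From mathcomp Require Import all_boot all_order all_algebra all_field.
From mathcomp Require Import reals.
From mathcomp.real_closed Require Import complex.

Set Implicit Arguments.
Unset Strict Implicit.
Unset Printing Implicit Defensive.

Import GRing.Theory.
Local Open Scope ring_scope.

(** * Gaussian binomial coefficients, from the q-Pascal rule *)

Fixpoint qbin (K : nzRingType) (r : K) (n a : nat) : K :=
  match n, a with
  | _, 0 => 1
  | 0, _.+1 => 0
  | n'.+1, a'.+1 => qbin r n' a' + r ^+ a'.+1 * qbin r n' a'.+1
  end.

Section QBinomial.

Variables (K : nzRingType) (r : K).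

Lemma qbin0 n : qbin r n 0 = 1.
Proof. by case: n. Qed.

Lemma qbin_gt n a : (n < a)%N -> qbin r n a = 0.
Proof.
elim: n a => [|n IHn] [|a] //= lt_na.
by rewrite !IHn ?mulr0 ?addr0 // ltnW.
Qed.

Lemma qbinn n : qbin r n n = 1.
Proof. by elim: n => //= n ->; rewrite qbin_gt // mulr0 addr0. Qed.

(** This is the quantum integer [n+1] that uniqueness divides by. *)
Lemma qbinSn n : qbin r n.+1 n = \sum_(i < n.+1) r ^+ i.
Proof.
elim: n => [|n IHn]; first by rewrite big_ord1.
by rewrite big_ord_recr /= -IHn /= -/(qbin r n.+1 n.+1) qbinn mulr1.
Qed.

End QBinomial.

(** * The q-binomial theorem for q-commuting elements *)

Section QCommuting.

Variables (K : comNzRingType) (B : algType K) (r : K) (x y : B).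
Hypothesis yx : y * x = r *: (x * y).

Lemma qcommX a b : y ^+ a * x ^+ b = r ^+ (a * b) *: (x ^+ b * y ^+ a).
Proof.
have yXx c : y ^+ c * x = r ^+ c *: (x * y ^+ c).
  elim: c => [|c IHc]; first by rewrite !expr0 scale1r mul1r mulr1.
  rewrite [in LHS]exprS -mulrA IHc -scalerAr [y * (x * _)]mulrA yx -scalerAl scalerA.
  by rewrite -exprSr -mulrA -exprS.
elim: b => [|b IHb]; first by rewrite muln0 !expr0 scale1r mul1r mulr1.
rewrite [in LHS]exprSr mulrA IHb -scalerAl -mulrA yXx -scalerAr scalerA mulrA.
by rewrite -exprD -exprSr -mulnSr.
Qed.

(** Multiply the n-th power by [x + y] on the right. The [y] part shifts [a], while moving [x] left
    past [y ^+ a] costs [r ^+ a]; these are the two terms of the Pascal rule. *)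
Lemma qbinomial n :
  (x + y) ^+ n = \sum_(a < n.+1) qbin r n a *: (x ^+ (n - a) * y ^+ a).
Proof.
elim: n => [|n IHn]; first by rewrite big_ord1 !expr0 scale1r mul1r.
rewrite exprSr IHn mulrDr !mulr_suml [RHS]big_ord_recl.
have -> : \sum_(i < n.+1) qbin r n.+1 (lift ord0 i) *:
      (x ^+ (n.+1 - lift ord0 i) * y ^+ (lift ord0 i))
    = \sum_(i < n) (r ^+ i.+1 * qbin r n i.+1) *: (x ^+ (n - i) * y ^+ i.+1)
      + \sum_(i < n.+1) qbin r n i *: (x ^+ (n - i) * y ^+ i.+1).
  transitivity (\sum_(i < n.+1)
    ((r ^+ i.+1 * qbin r n i.+1) *: (x ^+ (n - i) * y ^+ i.+1)
      + qbin r n i *: (x ^+ (n - i) * y ^+ i.+1))).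
    apply: eq_bigr => i _.
    by rewrite -scalerDl lift0 subSS /= addrC.
  rewrite big_split; congr (_ + _).
  (* The Pascal term at i = n drops out because [qbin r n n.+1] is 0. *)
  by rewrite big_ord_recr /= qbin_gt // mulr0 scale0r addr0.
rewrite addrA; congr (_ + _); last first.
  by apply: eq_bigr => i _; rewrite -scalerAl -mulrA -exprSr.
rewrite big_ord_recl !qbin0 !scale1r !subn0 !expr0 !mulr1 -exprSr.
congr (_ + _); apply: eq_bigr => i _; rewrite lift0 -scalerAl -mulrA.
have := qcommX i.+1 1; rewrite expr1 muln1 => ->.
rewrite -scalerAr scalerA mulrA -exprSr mulrC.
by rewrite -subSn // subSS.
Qed.

End QCommuting.

(** Shaped for the coproduct of a monomial: the two sums stand for [Delta etap] and [Delta etam],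
    and [z] for a power of [Delta delta]. *)
Lemma qbinomialM (K : comNzRingType) (B : algType K) (r s : K) (x y u v z : B)
    n m :
  y * x = r *: (x * y) -> v * u = s *: (u * v) ->
  (x + y) ^+ n * (u + v) ^+ m * z = \sum_(a < n.+1) \sum_(b < m.+1)
    (qbin r n a * qbin s m b)
      *: (x ^+ (n - a) * y ^+ a * (u ^+ (m - b) * v ^+ b) * z).
Proof.
move=> yx vu; rewrite (qbinomial yx) (qbinomial vu) !mulr_suml.
apply: eq_bigr => a _; rewrite mulr_sumr mulr_suml; apply: eq_bigr => b _.
by rewrite -!scalerAl -scalerAr -scalerAl scalerA.
Qed.

(** * Products, powers and scalars of pure tensors *)

Section TensorPowers.

Variables (K : fieldType) (A B : falgType K).

Lemma tensM (a c : A) (b d : B) : (a ⊗ b) * (c ⊗ d) = (a * c) ⊗ (b * d).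
Proof. exact: tmulE. Qed.

Lemma tensX (a : A) (b : B) n : (a ⊗ b) ^+ n = (a ^+ n) ⊗ (b ^+ n).
Proof. by elim: n => // n IHn; rewrite !exprS IHn tensM. Qed.

Lemma tensZl k (a : A) (b : B) : (k *: a) ⊗ b = k *: (a ⊗ b).
Proof. by apply/matrixP => i j; rewrite !mxE /tcoord linearZ /= mulrA. Qed.

Lemma tensZr k (a : A) (b : B) : a ⊗ (k *: b) = k *: (a ⊗ b).
Proof. by apply/matrixP => i j; rewrite !mxE /tcoord linearZ /= mulrCA. Qed.

End TensorPowers.

(** * Monomial coordinates and commutation rules *)

Section ReducedQuantumPoincare.

Variables (R : realType) (p : nat) (q : R[i]).
Hypotheses (p_gt1 : (1 < p)%N) (p_odd : odd p) (q_prim : p.-primitive_root q).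
Variables (A : falgType R[i]) (etap etam delta : A).
Hypothesis hE : E11_algebra p q etap etam delta.

Local Notation M n m k := (etap ^+ n * etam ^+ m * delta ^+ k).

Let p_gt0 : (0 < p)%N. Proof. exact: ltnW. Qed.

Lemma E11_mono_modp n m k : M n m (k %% p) = M n m k.
Proof. by rewrite -(expr_mod k (E11_delta_p hE)). Qed.

Definition E11_coord (t : 'I_p * 'I_p * 'I_p) : {scalar A} :=
  coord (codom_tuple (@monomial R p A etap etam delta)) (enum_rank t).

(** The exponent of [delta] is read modulo p, since the coproduct produces exponents beyond p; those
    of [etap] and [etam] never grow. *)
Lemma E11_coordM (i j l : 'I_p) n m k : (n < p)%N -> (m < p)%N ->
  E11_coord (i, j, l) (M n m k)
    = ((i == n :> nat) && (j == m :> nat) && (l == k %[mod p]))%:R.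
Proof.
move=> lt_n lt_m; rewrite -E11_mono_modp.
have lt_k : (k %% p < p)%N by rewrite ltn_mod.
pose t := (Ordinal lt_n, Ordinal lt_m, Ordinal lt_k).
have -> : M n m (k %% p)
    = (codom_tuple (@monomial R p A etap etam delta))`_(enum_rank t).
  by rewrite /= /codom /image_mem (nth_map t) -?cardE // nth_enum_rank.
rewrite /E11_coord /= coord_free ?(basis_free (E11_basis hE)) //.
rewrite eq_sym (inj_eq enum_rank_inj) !xpair_eqE -!val_eqE /=.
by rewrite (modn_small (ltn_ord l)).
Qed.

Lemma E11_ind (P : A -> Prop) :
  (forall k a b, P a -> P b -> P (k *: a + b)) -> P 0 ->
  (forall n m k, (n < p)%N -> (m < p)%N -> (k < p)%N -> P (M n m k)) ->
  forall a, P a.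
Proof.
move=> PL P0 PM a.
have : a \in <<codom_tuple (@monomial R p A etap etam delta)>>%VS.
  by rewrite (span_basis (E11_basis hE)) memvf.
move/coord_span=> ->.
apply: (big_ind P) => // [x y Px Py|i _].
  by rewrite -[x]scale1r; apply: PL.
rewrite -[_ *: _]addr0; apply: PL => //.
have /codomP[[[n m] k] ->] : (codom_tuple (@monomial R p A etap etam delta))`_i
    \in codom (@monomial R p A etap etam delta).
  by apply: mem_nth; rewrite size_tuple.
by apply: PM.
Qed.

Lemma q2_neq0 : q ^+ 2 != 0.
Proof.
rewrite expf_neq0 //; apply/eqP => q0; have := prim_expr_order q_prim.
by rewrite q0 expr0n gtn_eqF // => /esym/eqP; rewrite oner_eq0.
Qed.

Lemma E11_delta_unit : delta \is a GRing.unit.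
Proof.
apply/unitrP; exists (delta ^+ p.-1).
by rewrite -exprS -exprSr prednK // (E11_delta_p hE).
Qed.

(** Turns the inverse in [Delta etam] into a natural power, so that coproducts expand in
    monomials. *)
Lemma E11_deltaV : delta^-1 = delta ^+ p.-1.
Proof.
apply: (mulrI E11_delta_unit); rewrite mulrV ?E11_delta_unit //.
by rewrite -exprS prednK // (E11_delta_p hE).
Qed.

Lemma E11_delta_etap : delta * etap = q ^- 2 *: (etap * delta).
Proof. by rewrite (E11_etap_delta hE) scalerA mulVf ?scale1r ?q2_neq0. Qed.

Lemma E11_delta_etam : delta * etam = q ^- 2 *: (etam * delta).
Proof. by rewrite (E11_etam_delta hE) scalerA mulVf ?scale1r ?q2_neq0. Qed.

(** Passing to [delta^-1] inverts the factor, so the summands of [Delta etam] q-commute with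
    parameter [q ^+ 2], those of [Delta etap] with [q ^- 2]. *)
Lemma E11_deltaV_etam : delta^-1 * etam = q ^+ 2 *: (etam * delta^-1).
Proof.
have du := E11_delta_unit; apply: (mulIr du).
rewrite -mulrA (E11_etam_delta hE) -scalerAr mulKr // -scalerAl.
by rewrite divrK.
Qed.

(** If the geometric sum vanished, [q ^- 2] to the power n+1 would be 1, so p would divide 2(n+1),
    hence n+1 as p is odd; but 0 < n+1 < p. *)
Lemma qbinSn_neq0 n : (n.+1 < p)%N -> qbin (q ^- 2) n.+1 n != 0.
Proof.
move=> lt_n; rewrite qbinSn.
apply/eqP => sum0; have := subrX1 (q ^- 2) n.+1; rewrite sum0 mulr0 => /eqP.
rewrite subr_eq0 exprVn invr_eq1 -exprM -(prim_order_dvd q_prim).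
by rewrite Gauss_dvdr ?coprimen2 // gtnNdvd.
Qed.

(** * The coproduct of a monomial *)

Variable Delta : {lrmorphism A -> (A ⊗ A)%type}.
Hypothesis Delta_etap : Delta etap = etap ⊗ 1 + delta ⊗ etap.
Hypothesis Delta_etam : Delta etam = etam ⊗ 1 + delta^-1 ⊗ etam.
Hypothesis Delta_delta : Delta delta = delta ⊗ delta.

(** The last factor is the cost of moving [delta ^+ a] to the right of [etam ^+ (m - b)] in the left
    leg. *)
Definition cop_coef n m a b : R[i] :=
  qbin (q ^- 2) n a * qbin (q ^+ 2) m b * (q ^- 2) ^+ (a * (m - b)).

(* The exponent [p.-1 * b] stands for [- b]: [delta ^+ p = 1]. *)
Lemma DeltaM n m k :
  Delta (M n m k) = \sum_(a < n.+1) \sum_(b < m.+1) cop_coef n m a b *: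
    (M (n - a) (m - b) (a + p.-1 * b + k) ⊗ M a b k).
Proof.
rewrite !rmorphM !rmorphXn /= Delta_etap Delta_etam Delta_delta.
rewrite (@qbinomialM _ _ (q ^- 2) (q ^+ 2)); last 2 first.
- by rewrite !tensM mulr1 mul1r E11_delta_etap tensZl.
- by rewrite !tensM mulr1 mul1r E11_deltaV_etam tensZl.
apply: eq_bigr => a _; apply: eq_bigr => b _.
rewrite !tensX !expr1n !tensM !mul1r.
rewrite /cop_coef -[in RHS]scalerA; congr (_ *: _).
rewrite -tensZl; congr (_ ⊗ _).
rewrite E11_deltaV -exprM !exprD !mulrA -[_ * delta ^+ a * etam ^+ _]mulrA.
by rewrite (qcommX E11_delta_etam) -!scalerAr -!scalerAl !mulrA.
Qed.

Lemma id_tensDeltaM (J : {scalar A}) n m k :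
  id_tens J (Delta (M n m k)) = \sum_(a < n.+1) \sum_(b < m.+1)
    (cop_coef n m a b * J (M a b k))
      *: M (n - a) (m - b) (a + p.-1 * b + k).
Proof.
rewrite DeltaM /id_tens linear_sum; apply: eq_bigr => a _.
rewrite linear_sum; apply: eq_bigr => b _.
by rewrite linearZ /= -scalerA; congr (_ *: _); apply: id_tensE.
Qed.

Lemma tens_idDeltaM (J : {scalar A}) n m k :
  tens_id J (Delta (M n m k)) = \sum_(a < n.+1) \sum_(b < m.+1)
    (cop_coef n m a b * J (M (n - a) (m - b) (a + p.-1 * b + k)))
      *: M a b k.
Proof.
rewrite DeltaM /tens_id linear_sum; apply: eq_bigr => a _.
rewrite linear_sum; apply: eq_bigr => b _.
by rewrite linearZ /= -scalerA; congr (_ *: _); apply: tens_idE.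
Qed.

Lemma cop_coefnn n m : cop_coef n m n m = 1.
Proof. by rewrite /cop_coef !qbinn subnn muln0 expr0 !mulr1. Qed.

Lemma cop_coef00 n m : cop_coef n m 0 0 = 1.
Proof. by rewrite /cop_coef !qbin0 expr0 !mulr1. Qed.

(** * Invariance of functionals supported on the top monomial *)

Section Existence.

Variable J : {scalar A}.
Hypothesis J_top : forall n m k, (n < p)%N -> (m < p)%N ->
  ~~ [&& n == p.-1, m == p.-1 & k == 0 %[mod p]] -> J (M n m k) = 0.

Lemma invariant_integral_top : invariant_integral Delta J.
Proof.
have ltp a n : (n < p)%N -> (a < n)%N -> (a == p.-1) = false.
  by move=> lt_n lt_a; rewrite ltn_eqF // -ltnS prednK // (leq_trans _ lt_n).
(* Subtraction is truncated: n = 0 gives 0, which differs from p-1 because p > 1. *)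
have gtp a n : (n < p)%N -> (n - a.+1 == p.-1)%N = false.
  move=> lt_n; rewrite ltn_eqF //; case: n lt_n => [|n] lt_n.
    by rewrite -subn1 subn_gt0.
  by rewrite subSS (leq_ltn_trans (leq_subr _ _)) // -ltnS prednK.
move=> a; elim/E11_ind: a => [c a b [IHa1 IHa2] [IHb1 IHb2]| |n m k lt_n lt_m lt_k].
- rewrite !linearP /= scalerDl -scalerA; split.
    by rewrite -IHa1 -IHb1 /id_tens linearP.
  by rewrite -IHa2 -IHb2 /tens_id linearP.
- by rewrite !linear0 /id_tens /tens_id !linear0 scale0r.
split.
  rewrite id_tensDeltaM big_ord_recr /= big1 ?add0r => [|a _]; last first.
    rewrite big1 // => b _.
    rewrite J_top ?mulr0 ?scale0r ?(ltp a n) //.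
      exact: ltn_trans (ltn_ord a) lt_n.
    exact: leq_trans (ltn_ord b) lt_m.
  rewrite big_ord_recr /= big1 ?add0r => [|b _]; last first.
    rewrite J_top ?mulr0 ?scale0r ?(ltp b m) ?andbF //.
    exact: ltn_trans (ltn_ord b) lt_m.
  rewrite cop_coefnn mul1r !subnn !expr0 !mul1r.
  case: (boolP [&& n == p.-1, m == p.-1 & k == 0 %[mod p]]); last first.
    by move=> not_top; rewrite J_top ?scale0r.
  case/and3P=> /eqP-> /eqP-> /eqP k0.
  (* At the top, n + (p-1)m = p(p-1), so this power of [delta] is 1. *)
  rewrite -mulSn prednK // exprD exprM (E11_delta_p hE) expr1n mul1r.
  by rewrite -(expr_mod k (E11_delta_p hE)) k0 mod0n expr0.
rewrite tens_idDeltaM big_ord_recl [X in _ + X]big1 ?addr0 => [|a _]; last first.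
  rewrite big1 // => b _; rewrite lift0 J_top ?mulr0 ?scale0r ?gtp //.
    exact: leq_ltn_trans (leq_subr _ _) lt_n.
  exact: leq_ltn_trans (leq_subr _ _) lt_m.
rewrite big_ord_recl [X in _ + X]big1 ?addr0 => [|b _]; last first.
  rewrite lift0 J_top ?mulr0 ?scale0r ?gtp ?andbF //.
    exact: leq_ltn_trans (leq_subr _ _) lt_n.
  exact: leq_ltn_trans (leq_subr _ _) lt_m.
(* The right leg left over is [delta ^+ k], which is 1 whenever [J] does not vanish. *)
rewrite cop_coef00 mul1r !subn0 muln0 !add0n !expr0 !mul1r.
case: (boolP (k == 0 %[mod p])) => [/eqP k0|k_neq0]; last first.
  by rewrite J_top ?scale0r // !negb_and k_neq0 !orbT.
by rewrite -(expr_mod k (E11_delta_p hE)) k0 mod0n expr0.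
Qed.

End Existence.

(** * Vanishing of an invariant functional off the top monomial *)

Section Uniqueness.

Variable J : {scalar A}.
Hypothesis J_inv : invariant_integral Delta J.

Let o0 := Ordinal p_gt0.

Let coord1 (t : 'I_p * 'I_p * 'I_p) :
  E11_coord t 1 = (t == (o0, o0, o0))%:R.
Proof.
case: t => [[i j] l]; have := @E11_coordM i j l 0 0 0 p_gt0 p_gt0.
rewrite !expr0 !mulr1 => ->.
by rewrite !xpair_eqE -!val_eqE /= mod0n modn_small.
Qed.

(** Compare coefficients of [delta ^+ k] in right legs: only (0, 0) yields a pure power of [delta],
    and a multiple of 1 has coefficient 0 there. *)
Lemma invariant_integral_delta n m k : (n < p)%N -> (m < p)%N ->
  k != 0 %[mod p] -> J (M n m k) = 0.
Proof.
move=> lt_n lt_m k_neq0.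
pose t := (o0, o0, Ordinal (ltn_pmod k p_gt0)).
have [_] := J_inv (M n m k).
move/(congr1 (E11_coord t)); rewrite linearZ /= coord1 !xpair_eqE -!val_eqE /=.
rewrite mod0n in k_neq0; rewrite (negPf k_neq0) mulr0 => <-.
rewrite tens_idDeltaM linear_sum big_ord_recl [X in _ + X]big1 ?addr0 => [|a _]; last first.
  rewrite linear_sum big1 // => b _; rewrite linearZ /= E11_coordM ?mulr0 //.
    exact: leq_ltn_trans (ltn_ord a) lt_n.
  exact: leq_trans (ltn_ord b) lt_m.
rewrite linear_sum big_ord_recl [X in _ + X]big1 ?addr0 => [|b _]; last first.
  rewrite linearZ /= E11_coordM ?mulr0 //.
  exact: leq_ltn_trans (ltn_ord b) lt_m.
rewrite linearZ /= E11_coordM //= modn_mod eqxx mulr1.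
by rewrite cop_coef00 mul1r !subn0 muln0 !add0n.
Qed.

(** The mirror argument on left legs: only (n, m) yields a pure power of [delta], whose exponent
    represents n - m + k. *)
Lemma invariant_integral_diag n m k : (n < p)%N -> (m < p)%N ->
  n + p.-1 * m + k != 0 %[mod p] -> J (M n m k) = 0.
Proof.
move=> lt_n lt_m k_neq0.
pose t := (o0, o0, Ordinal (ltn_pmod (n + p.-1 * m + k) p_gt0)).
have [+ _] := J_inv (M n m k).
move/(congr1 (E11_coord t)); rewrite linearZ /= coord1 !xpair_eqE -!val_eqE /=.
rewrite mod0n in k_neq0; rewrite (negPf k_neq0) mulr0 => <-.
have sub_lt i j : (i < p)%N -> (i - j < p)%N by apply: leq_ltn_trans (leq_subr _ _).
rewrite id_tensDeltaM linear_sum big_ord_recr /= big1 ?add0r => [|a _]; last first.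
  rewrite linear_sum big1 // => b _; rewrite linearZ /= E11_coordM ?sub_lt //.
  by rewrite eq_sym subn_eq0 leqNgt ltn_ord mulr0.
rewrite linear_sum big_ord_recr /= big1 ?add0r => [|b _]; last first.
  rewrite linearZ /= E11_coordM ?sub_lt //.
  by rewrite [(0 == _ - b)%N]eq_sym subn_eq0 leqNgt ltn_ord andbF mulr0.
rewrite linearZ /= E11_coordM ?sub_lt // !subnn eqxx modn_mod eqxx mulr1.
by rewrite cop_coefnn mul1r.
Qed.

Lemma invariant_integral_low n : (n.+1 < p)%N -> J (M n n 0) = 0.
Proof.
move=> lt_n; have lt_n' := ltnW lt_n.
pose t := (Ordinal p_gt1, o0, o0).
have [+ _] := J_inv (M n.+1 n 0).
move/(congr1 (E11_coord t)); rewrite linearZ /= coord1 !xpair_eqE -!val_eqE /=.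
rewrite mulr0.
have sub_lt i j : (i < p)%N -> (i - j < p)%N by apply: leq_ltn_trans (leq_subr _ _).
(* In the coefficient of [etap], the row a = n+1 has no [etap] in its left leg, and the rows a < n
   have at least its square. *)
rewrite id_tensDeltaM linear_sum big_ord_recr /= [X in _ + X]linear_sum /=.
rewrite [X in _ + X]big1 ?addr0 => [|b _]; last first.
  by rewrite linearZ /= E11_coordM ?sub_lt // subnn mulr0.
rewrite big_ord_recr /= big1 ?add0r => [|a _]; last first.
  rewrite linear_sum big1 // => b _; rewrite linearZ /= E11_coordM ?sub_lt //.
  by rewrite subSn 1?ltnW // eqSS eq_sym subn_eq0 leqNgt ltn_ord mulr0.
(* In the row a = n, any b < n leaves a power of [etam] in the left leg. The surviving term b = n
   carries [delta] to the power pn, that is 1. *)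
rewrite linear_sum big_ord_recr /= big1 ?add0r => [|b _]; last first.
  rewrite linearZ /= E11_coordM ?sub_lt //.
  by rewrite [(0 == _ - b)%N]eq_sym subn_eq0 leqNgt ltn_ord andbF mulr0.
rewrite linearZ /= E11_coordM ?sub_lt // subSnn subnn addn0 -mulSn prednK //.
rewrite modnMr mod0n mulr1 /cop_coef qbinn mulr1 subnn muln0 expr0 mulr1.
by move/eqP; rewrite mulf_eq0 (negPf (qbinSn_neq0 lt_n)) => /eqP.
Qed.

Lemma invariant_integral_eq0 n m k : (n < p)%N -> (m < p)%N ->
  ~~ [&& n == p.-1, m == p.-1 & k == 0 %[mod p]] -> J (M n m k) = 0.
Proof.
move=> lt_n lt_m; case: (boolP (k == 0 %[mod p])) => [/eqP k0|k_neq0 _]; last first.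
  exact: invariant_integral_delta.
rewrite andbT -E11_mono_modp k0 mod0n => not_top.
have [nm|neq_nm] := eqVneq n m.
  rewrite -nm; apply: invariant_integral_low; rewrite ltn_neqAle lt_n andbT.
  by apply: contra not_top => /eqP <-; rewrite -nm eqxx.
apply: invariant_integral_diag => //; apply: contraNneq neq_nm.
rewrite addn0 => nm0.
(* Adding m to n + (p-1)m = 0 modulo p gives n = m modulo p, hence n = m as both are below p. *)
have : n + p * m = m %[mod p].
  have -> : (p * m = m + p.-1 * m)%N by rewrite -mulSn prednK.
  by rewrite addnCA -modnDmr nm0 mod0n addn0.
by rewrite mulnC addnC modnMDl !modn_small // => ->.
Qed.

End Uniqueness.

End ReducedQuantumPoincare.

(** * The integral as a rescaled top coordinate *)

Theorem theorem1 (R : realType) (p : nat) (q : R[i])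
    (p_ge3 : (3 <= p)%N) (p_odd : odd p) (q_prim : p.-primitive_root q)
    (A : falgType R[i]) (etap etam delta : A)
    (Delta : {lrmorphism A -> (A ⊗ A)%type}) (eps : {lrmorphism A -> R[i]^o})
    (S : {linear A -> A})
    (hA : reduced_quantum_Poincare p q etap etam delta Delta eps S) :
  exists I : {scalar A},
    [/\ forall n m k : 'I_p,
          I (etap ^+ n * etam ^+ m * delta ^+ k) =
            q^-1 * (n == p.-1 :> nat)%:R * (m == p.-1 :> nat)%:R
              * (k == 0 %[mod p])%:R,
        invariant_integral Delta I
      & forall J : {scalar A}, invariant_integral Delta J ->
          exists c : R[i], forall a, J a = c * I a].
Proof.
have hE := rqP_algebra hA.
have p_gt1 : (1 < p)%N := ltnW p_ge3.
have p_gt0 : (0 < p)%N := ltnW p_gt1.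
have q_neq0 : q != 0.
  by apply: contraNneq (q2_neq0 p_gt1 q_prim) => ->; rewrite expr0n.
have lt_top : (p.-1 < p)%N by rewrite prednK.
pose top := Ordinal lt_top; pose o0 := Ordinal p_gt0.
pose C := E11_coord etap etam delta (top, top, o0).
have I_lin : linear_for *%R (fun a : A => q^-1 * C a).
  by move=> k x y; rewrite linearP /= mulrDr mulrCA.
pose I : {scalar A} := HB.pack (fun a : A => q^-1 * C a)
  (GRing.isLinear.Build _ _ _ _ _ I_lin).
have IM n m k : (n < p)%N -> (m < p)%N ->
    I (etap ^+ n * etam ^+ m * delta ^+ k)
      = q^-1 * (n == p.-1)%:R * (m == p.-1)%:R * (k == 0 %[mod p])%:R.
  move=> lt_n lt_m; rewrite /I /= (E11_coordM p_gt1 hE) //=.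
  by rewrite -!mulrA -!natrM !mulnb andbA !(eq_sym p.-1) (eq_sym (0 %% p)%N).
exists I; split=> [n m k| |J J_inv]; first exact: IM.
  apply: (invariant_integral_top p_gt1 q_prim hE) => //.
  - exact: rqP_Delta_etap hA.
  - exact: rqP_Delta_etam hA.
  - exact: rqP_Delta_delta hA.
  move=> n m k lt_n lt_m; rewrite IM // -!mulrA -!natrM !mulnb => /negPf->.
  exact: mulr0.
(* The ratio of [J] to [I] at the top monomial, where [I] equals [q^-1]. *)
exists (q * J (etap ^+ p.-1 * etam ^+ p.-1 * delta ^+ 0)) => a.
elim/(E11_ind hE): a => [c a b IHa IHb| |n m k lt_n lt_m _].
- by rewrite !linearP /= IHa IHb mulrDr mulrCA.
- by rewrite !linear0 mulr0.
rewrite IM //.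
have [|not_top] := boolP [&& n == p.-1, m == p.-1 & k == 0 %[mod p]].
  case/and3P=> /eqP-> /eqP-> /eqP k0; rewrite !eqxx !mulr1 k0 eqxx mulr1.
  by rewrite -(E11_mono_modp hE) k0 mod0n mulrAC mulfV // mul1r expr0 mulr1.
rewrite (invariant_integral_eq0 p_gt1 p_odd q_prim hE _ _ _ J_inv) //.
- by rewrite -!mulrA -!natrM !mulnb (negPf not_top) !mulr0.
- exact: rqP_Delta_etap hA.
- exact: rqP_Delta_etam hA.
- exact: rqP_Delta_delta hA.
Qed.
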